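(* Vertex deletion and edge deletion can each either increase or decrease $Z_g$, even when the resulting graph is connected. That is: there exist a connected graph $G$ and a vertex $v$ of $G$ with $G-v$ connected and $Z_g(G-v)>Z_g(G)$; there exist a connected graph $G$ and a vertex $v$ with $G-v$ connected and $Z_g(G-v)<Z_g(G)$; there exist a connected graph $G$ and an edge $e$ of $G$ with $G-e$ connected and $Z_g(G-e)>Z_g(G)$; and there exist a connected graph $G$ and an edge $e$ with $G-e$ connected and $Z_g(G-e)<Z_g(G)$. Consequently, $Z_g$ is not minor-monotone: there exist connected graphs $G$ and $H$ with $H$ a minor of $G$ and $Z_g(H)>Z_g(G)$.
   Context: All graphs are finite and simple; $Z_g$ is defined for connected graphs with at least one edge, so all graphs whose $Z_g$ is mentioned are of this kind. The game: Let $G$ be a connected graph with at least one edge; initially all vertices are white. Alice (blue) and Bob (red) alternate turns, Alice first. On each turn the player makes exactly one move: a seed move (colour one white vertex with the player's colour) or a force move $u\to v$ (if a vertex $u$ of the player's colour has exactly one white neighbour $v$, colour $v$ with the player's colour). Being the unique white neighbour is with respect to all white vertices, irrespective of who coloured the others. If a white vertex is the target of one of the player's own legal forces, colouring it counts as a force move and not as a seed move. A move blocks a legal force $u\to v$ if that force is no longer legal after the move. Force Preservation Rule: considering the opponent's legal forces (those the opponent's coloured vertices could make) at the beginning of a turn, (i) a player may always perform one of their own legal forces, even if this blocks a force of the opponent; (ii) a seed move that blocks a legal force of the opponent is permitted only when every available seed move blocks at least one of the opponent's legal forces. The game ends when every vertex is coloured. Optimal play and $Z_g$: For a position $P$ define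 a set $\mathcal O(P)$ of pairs. If $P$ is terminal and Alice and Bob made $s_A$ and $s_B$ seed moves in total, then $\mathcal O(P)=\{(s_A,s_B)\}$. Otherwise let $\mathcal U(P)=\bigcup_m \mathcal O(P_m)$ over all legal moves $m$, where $P_m$ is the resulting position; $\mathcal O(P)$ is the set of all pairs in $\mathcal U(P)$ with minimum first coordinate if Alice is to move, and with minimum second coordinate if Bob is to move. Let $\mathcal O(G)=\mathcal O(P_0(G))$ for the initial position $P_0(G)$. The game zero forcing number is $Z_g(G)=\min\{s_A+s_B:(s_A,s_B)\in\mathcal O(G)\}$. *)

(* Defs.v *)
From HB Require Import structures.
From mathcomp Require Import all_boot.

Set Implicit Arguments.
Unset Strict Implicit.
Unset Printing Implicit Defensive.

Record sgraph := SGraph {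
  vertex :> finType;
  edge : rel vertex;
  edge_sym : symmetric edge;
  edge_irr : irreflexive edge
}.

Notation "x -- y" := (edge x y) (at level 30).

Definition connected (G : sgraph) : Prop :=
  0 < #|G| /\ forall x y : G, connect (@edge G) x y.

Definition has_edge (G : sgraph) : Prop := exists x y : G, x -- y.

Definition game_graph (G : sgraph) : Prop := connected G /\ has_edge G.

Section Operations.
Variable G : sgraph.

Definition del_vertex_rel (v : G) : rel {z : G | z != v} :=
  fun a b => val a -- val b.

Lemma del_vertex_sym v : symmetric (@del_vertex_rel v).
Proof. by move=> a b; apply: edge_sym. Qed.

Lemma del_vertex_irr v : irreflexive (@del_vertex_rel v).
Proof. by move=> a; apply: edge_irr. Qed.

Definition del_vertex (v : G) : sgraph :=
  SGraph (@del_vertex_sym v) (@del_vertex_irr v).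

Definition del_edge_rel (x y : G) : rel G :=
  fun a b => (a -- b) && ([set a; b] != [set x; y]).

Lemma del_edge_sym x y : symmetric (del_edge_rel x y).
Proof. by move=> a b; rewrite /del_edge_rel edge_sym setUC. Qed.

Lemma del_edge_irr x y : irreflexive (del_edge_rel x y).
Proof. by move=> a; rewrite /del_edge_rel edge_irr. Qed.

Definition del_edge (x y : G) : sgraph :=
  SGraph (del_edge_sym x y) (del_edge_irr x y).

(* Contraction of the edge x -- y: y is merged into x. *)
Definition contract_rel (x y : G) : rel {z : G | z != y} :=
  fun a b => (val a != val b) &&
    [|| val a -- val b, (val a == x) && (y -- val b)
      | (val b == x) && (y -- val a)].

Lemma contract_sym x y : symmetric (@contract_rel x y).
Proof.
move=> a b; rewrite /contract_rel eq_sym (edge_sym (val a)).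
by rewrite [(val a == x) && _ || _]orbC.
Qed.

Lemma contract_irr x y : irreflexive (@contract_rel x y).
Proof. by move=> a; rewrite /contract_rel eqxx. Qed.

Definition contract (x y : G) : sgraph :=
  SGraph (@contract_sym x y) (@contract_irr x y).

End Operations.

Definition isomorphic (G H : sgraph) : Prop :=
  exists f : G -> H, bijective f /\ forall x y : G, (f x -- f y) = (x -- y).

Inductive minor (G : sgraph) : sgraph -> Prop :=
| minor_iso (H : sgraph) : isomorphic G H -> minor G H
| minor_del_vertex (H H' : sgraph) (v : H) :
    minor G H -> isomorphic (del_vertex v) H' -> minor G H'
| minor_del_edge (H H' : sgraph) (x y : H) :
    minor G H -> x -- y -> isomorphic (del_edge x y) H' -> minor G H'
| minor_contract (H H' : sgraph) (x y : H) :
    minor G H -> x -- y -> isomorphic (contract x y) H' -> minor G H'.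

Inductive player := Alice | Bob.

Definition is_Alice (p : player) := if p is Alice then true else false.
Definition player_of_bool (b : bool) := if b then Alice else Bob.
Lemma is_AliceK : cancel is_Alice player_of_bool. Proof. by case. Qed.
HB.instance Definition _ := Equality.copy player (can_type is_AliceK).

Definition opponent (p : player) := if p is Alice then Bob else Alice.

(* Pairs of naturals are indexed as (Alice, Bob). *)
Definition coord (p : player) (q : nat * nat) := if p is Alice then q.1 else q.2.

Definition incr (p : player) (q : nat * nat) : nat * nat :=
  if p is Alice then (q.1.+1, q.2) else (q.1, q.2.+1).

Section Game.
Variable G : sgraph.

(* [None] is white, [Some p] is the colour of player [p]. *)
Definition colouring := G -> option player.

Implicit Types (c : colouring) (p : player) (u v w : G).

Definition white c v : bool := ~~ isSome (c v).

Definition colour c p v : colouring := [eta c with v |-> Some p].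

Definition legal_force c p u v : bool :=
  (c u == Some p) && ([set w | (u -- w) && white c w] == [set v]).

(* A white vertex that is the target of an own legal force cannot be seeded. *)
Definition available_seed c p v : bool :=
  white c v && ~~ [exists u, legal_force c p u v].

Definition blocks c p v : bool :=
  [exists u, exists w, legal_force c (opponent p) u w
                       && ~~ legal_force (colour c p v) (opponent p) u w].

Inductive move := Seed of G | Force of G & G.

Definition legal c p (m : move) : bool :=
  match m with
  | Force u v => legal_force c p u v
  | Seed v =>
      available_seed c p v &&
      (~~ blocks c p v || [forall w, available_seed c p w ==> blocks c p w])
  end.

Definition all_moves : seq move :=
  [seq Seed v | v <- enum G] ++ [seq Force u v | u <- enum G, v <- enum G].

(* [seeds] counts the seed moves made so far by Alice and by Bob. *)
Record position := Position {
  turn : player;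
  colours : colouring;
  seeds : nat * nat
}.

Definition terminal (P : position) : bool := [forall v, ~~ white (colours P) v].

Definition play (P : position) (m : move) : position :=
  let: Position p c s := P in
  match m with
  | Seed v => Position (opponent p) (colour c p v) (incr p s)
  | Force _ v => Position (opponent p) (colour c p v) s
  end.

Definition legal_moves (P : position) : seq move :=
  [seq m <- all_moves | legal (colours P) (turn P) m].

(* The finite set O(P), as a list. Every move colours one white vertex, so
   any fuel n at least the number of white vertices yields the same result. *)
Fixpoint outcomes (n : nat) (P : position) : seq (nat * nat) :=
  if terminal P then [:: seeds P] else
  if n is n'.+1 then
    let U := undup (flatten [seq outcomes n' (play P m) | m <- legal_moves P]) in
    [seq q <- U | all (fun q' => coord (turn P) q <= coord (turn P) q') U]
  else [::].

Definition initial : position := Position Alice (fun=> None) (0, 0).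

(* The default value #|G| does not affect the minimum: a non-terminal position
   always has a legal move, so there is at least one outcome, and each vertex is
   coloured once, so s_A + s_B <= #|G| for every outcome (s_A, s_B). *)
Definition Zg : nat :=
  \big[minn/#|G|]_(q <- outcomes #|G| initial) (q.1 + q.2).

End Game.

(* Main.v *)
(* Three of the examples involve the claw K_{1,3}, which has Z_g = 3: deleting a
   leaf leaves a path with Z_g = 2, while the claw itself arises by deleting
   one edge from the paw (a triangle with a pendant edge) and by deleting one
   vertex from the spider (the claw with one edge subdivided), both of which
   have Z_g = 2.  For edge deletion that decreases Z_g, take K_4, with Z_g = 3,
   and K_4 minus an edge, with Z_g = 2.  The values of Z_g are found by
   exhausting the game tree. *)
Require Import Defs.
From mathcomp Require Import all_boot.

Set Implicit Arguments.
Unset Strict Implicit.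
Unset Printing Implicit Defensive.

(** * Minima and unions over lists, regardless of order *)

Lemma leq_bigmin (T : eqType) (F : T -> nat) (n m : nat) (l : seq T) :
  (m <= \big[minn/n]_(q <- l) F q) = (m <= n) && all (fun q => m <= F q) l.
Proof.
elim: l => [|q l IH]; first by rewrite big_nil andbT.
by rewrite big_cons leq_min IH andbCA.
Qed.

(** Both minima have the same lower bounds, since these depend only on the default and on which
    elements occur. *)
Lemma eq_mem_bigmin (T : eqType) (F : T -> nat) (n : nat) (l1 l2 : seq T) :
  l1 =i l2 -> \big[minn/n]_(q <- l1) F q = \big[minn/n]_(q <- l2) F q.
Proof.
move=> eq_l.
suff eq_le m :
    (m <= \big[minn/n]_(q <- l1) F q) = (m <= \big[minn/n]_(q <- l2) F q).
  by apply/eqP; rewrite eqn_leq -eq_le leqnn eq_le leqnn.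
by rewrite !leq_bigmin (eq_all_r eq_l).
Qed.

Lemma has_flatten (T : Type) (a : pred T) (ss : seq (seq T)) :
  has a (flatten ss) = has (has a) ss.
Proof. by elim: ss => //= t ss IH; rewrite has_cat IH. Qed.

(** Turns membership in the union over legal moves into a [has], which is insensitive to the order
    in which moves are listed. *)
Lemma mem_flatten_filter (T : Type) (S : eqType) (F : T -> seq S) (a : pred T)
    (l : seq T) (q : S) :
  (q \in flatten [seq F m | m <- l & a m]) = has (fun m => a m && (q \in F m)) l.
Proof.
elim: l => //= m l IH; case: (a m) => //=.
by rewrite mem_cat IH.
Qed.

(* [enum], finite sets, boolean quantifiers over a finType and big operators do
   not reduce; these copies of the definitions of the game, relative to an
   explicit list [s] of the vertices and a computable edge relation [e], do. *)
Section ComputableGame.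
Variables (G : sgraph) (e : rel G) (s : seq G).

Definition cforce (c : colouring G) p (u v : G) : bool :=
  (c u == Some p) && all (fun w => (e u w && white c w) == (w == v)) s.

Definition cavailable (c : colouring G) p v : bool :=
  white c v && ~~ has (fun u => cforce c p u v) s.

Definition cblocks (c : colouring G) p v : bool :=
  has (fun u => has (fun w => cforce c (opponent p) u w
    && ~~ cforce (colour c p v) (opponent p) u w) s) s.

Definition clegal (c : colouring G) p (m : move G) : bool :=
  match m with
  | Force u v => cforce c p u v
  | Seed v => cavailable c p v &&
      (~~ cblocks c p v || all (fun w => cavailable c p w ==> cblocks c p w) s)
  end.

Definition cmoves : seq (move G) :=
  [seq Seed v | v <- s] ++ [seq Force u v | u <- s, v <- s].

Fixpoint coutcomes (n : nat) (P : position G) : seq (nat * nat) :=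
  if all (fun v => ~~ white (colours P) v) s then [:: seeds P] else
  if n is n'.+1 then
    let U := undup (flatten [seq coutcomes n' (play P m)
                            | m <- cmoves & clegal (colours P) (turn P) m]) in
    [seq q <- U | all (fun q' => coord (turn P) q <= coord (turn P) q') U]
  else [::].

Definition cZg : nat :=
  foldr minn (size s)
    [seq q.1 + q.2 | q <- coutcomes (size s) (initial G)].

(** A test for [game_graph] that reduces, unlike [connect]. Radius two suffices for every graph used
    below. *)
Definition within_two (r : G) : bool :=
  all (fun x => [|| x == r, e r x | has (fun y => e r y && e y x) s]) s &&
  has (e r) s.

Hypotheses (eE : e =2 @edge G) (s_all : forall x, x \in s).

Lemma forall_all (a : pred G) : [forall x, a x] = all a s.
Proof. by apply/forallP/allP => [h x _ | h x]; apply: h. Qed.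

Lemma exists_has (a : pred G) : [exists x, a x] = has a s.
Proof. by apply/existsP/hasP => [[x ax] | [x _ ax]]; exists x. Qed.

Lemma cforceE c p : legal_force c p =2 cforce c p.
Proof.
move=> u v; rewrite /legal_force /cforce; congr (_ && _).
apply/eqP/allP => [/setP h w _ | h].
  by have := h w; rewrite !inE eE => ->.
by apply/setP => w; rewrite !inE -eE; apply/eqP/h.
Qed.

Lemma cavailableE c p : available_seed c p =1 cavailable c p.
Proof.
move=> v; rewrite /available_seed /cavailable exists_has.
by congr (_ && ~~ _); apply: eq_has => u; apply: cforceE.
Qed.

Lemma cblocksE c p : @blocks G c p =1 cblocks c p.
Proof.
move=> v; rewrite /blocks /cblocks exists_has; apply: eq_has => u.
by rewrite exists_has; apply: eq_has => w; rewrite !cforceE.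
Qed.

Lemma clegalE c p : @legal G c p =1 clegal c p.
Proof.
case=> [v|u v] /=; last exact: cforceE.
rewrite cavailableE cblocksE forall_all; congr (_ && (_ || _)).
by apply: eq_all => w; rewrite cavailableE cblocksE.
Qed.

Lemma has_cmoves (a : pred (move G)) : has a (all_moves G) = has a cmoves.
Proof.
have enum_s : enum G =i s by move=> x; rewrite mem_enum s_all.
rewrite /all_moves; move: (enum G) enum_s => t t_s.
rewrite !has_cat !has_map (eq_has_r t_s); congr (_ || _).
rewrite !has_flatten !has_map (eq_has_r t_s).
by apply: eq_has => u /=; rewrite !has_map (eq_has_r t_s).
Qed.

(** Only equality as sets can be expected, as [enum G] and [s] may be ordered differently. It
    survives the induction because selecting the optimal pairs depends only on the set of
    candidates. *)
Lemma coutcomesE n P : @outcomes G n P =i coutcomes n P.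
Proof.
elim: n P => [|n IH] P q; rewrite /= /terminal forall_all; case: ifP => // _.
set U := undup _; set V := undup _.
have UV : U =i V.
  move=> r; rewrite !mem_undup !mem_flatten_filter has_cmoves.
  by apply: eq_has => m; rewrite clegalE IH.
by rewrite !mem_filter UV (eq_all_r UV).
Qed.

Lemma cZgE : uniq s -> Zg G = cZg.
Proof.
move=> s_uniq.
(* This number is both the fuel and the default value of the minimum. *)
have sizeG : #|G| = size s.
  by rewrite -(card_uniqP s_uniq); apply: eq_card => x; rewrite s_all.
rewrite /Zg sizeG (eq_mem_bigmin _ _ (coutcomesE _ _)) unlock /cZg.
by elim: coutcomes => //= q l ->.
Qed.

Lemma within_two_game_graph r : within_two r -> game_graph G.
Proof.
case/andP => /allP near_r /hasP[z _ rz].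
have r_conn x : connect (@edge G) r x.
  have := near_r x (s_all x).
  case/or3P => [/eqP-> | | /hasP[y _ /andP[]]]; rewrite ?connect0 // !eE.
    exact: connect1.
  by move=> /connect1 ry /connect1; apply: connect_trans.
split; last by exists r, z; rewrite -eE.
split; first by apply/card_gt0P; exists r.
move=> x y; apply: connect_trans (r_conn y).
by rewrite (sym_connect_sym (@edge_sym G)).
Qed.

End ComputableGame.

(** * Concrete graphs and their deletions *)

Section ListGraph.
Variables (n : nat) (l : seq (nat * nat)).

Definition list_rel : rel 'I_n := fun a b =>
  (val a != val b) && (((val a, val b) \in l) || ((val b, val a) \in l)).

Lemma list_rel_sym : symmetric list_rel.
Proof. by move=> a b; rewrite /list_rel eq_sym orbC. Qed.

Lemma list_rel_irr : irreflexive list_rel.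
Proof. by move=> a; rewrite /list_rel eqxx. Qed.

Definition list_graph : sgraph := SGraph list_rel_sym list_rel_irr.

End ListGraph.

Lemma eq_set2 (T : finType) (a b x y : T) :
  ([set a; b] == [set x; y]) = (a == x) && (b == y) || (a == y) && (b == x).
Proof.
apply/eqP/idP => [/setP eq_ab | /orP[] /andP[/eqP-> /eqP->] //]; last exact: setUC.
(* Membership of the four named elements leaves a propositional identity in the four equalities
   between [a], [b] and [x], [y]. *)
have := eq_ab a; have := eq_ab b; have := eq_ab x; have := eq_ab y.
rewrite !inE !eqxx !orbT /= !(eq_sym x) !(eq_sym y).
by do 4![case: (_ == _)].
Qed.

Definition cdel_edge (G : sgraph) (e : rel G) (x y : G) : rel G :=
  fun a b => e a b && ~~ ((a == x) && (b == y) || (a == y) && (b == x)).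

Lemma cdel_edgeE (G : sgraph) (x y : G) :
  cdel_edge (@edge G) x y =2 @edge (del_edge x y).
Proof. by move=> a b; rewrite /= /del_edge_rel eq_set2. Qed.

(* [insub_eq] is the variant of [insub] that reduces. *)
Definition cord_enum (n : nat) : seq 'I_n := pmap (@insub_eq _ _ 'I_n) (iota 0 n).

Lemma cord_enumE n : cord_enum n = ord_enum n.
Proof. by apply: eq_pmap; apply: insub_eqE. Qed.

Lemma mem_cord_enum n (i : 'I_n) : i \in cord_enum n.
Proof. by rewrite cord_enumE mem_ord_enum. Qed.

Lemma cord_enum_uniq n : uniq (cord_enum n).
Proof. by rewrite cord_enumE ord_enum_uniq. Qed.

Definition cdel_vertex (G : sgraph) (s : seq G) (v : G) : seq (del_vertex v) :=
  pmap (@insub_eq _ _ (del_vertex v)) s.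

Lemma cdel_vertexE (G : sgraph) (s : seq G) (v : G) :
  cdel_vertex s v = pmap insub s.
Proof. by apply: eq_pmap; apply: insub_eqE. Qed.

Lemma mem_cdel_vertex (G : sgraph) (s : seq G) (v : G) :
  (forall x, x \in s) -> forall x, x \in cdel_vertex s v.
Proof. by move=> s_all x; rewrite cdel_vertexE mem_pmap_sub. Qed.

Lemma cdel_vertex_uniq (G : sgraph) (s : seq G) (v : G) :
  uniq s -> uniq (cdel_vertex s v).
Proof. by rewrite cdel_vertexE; apply: pmap_sub_uniq. Qed.

Definition claw := list_graph 4 [:: (0, 1); (0, 2); (0, 3)].
Definition paw := list_graph 4 [:: (0, 1); (0, 2); (0, 3); (1, 2)].
Definition K4 :=
  list_graph 4 [:: (0, 1); (0, 2); (0, 3); (1, 2); (1, 3); (2, 3)].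
Definition spider := list_graph 5 [:: (0, 1); (0, 2); (0, 3); (1, 4)].

(** Leaves two closed computations as goals. The relation [e] is kept apart from [edge] because edge
    deletion compares finite sets. *)
Lemma game_graph_Zg (G : sgraph) (e : rel G) (s : seq G) (r : G) k :
  e =2 @edge G -> (forall x, x \in s) -> uniq s ->
  within_two e s r -> cZg e s = k -> game_graph G /\ Zg G = k.
Proof.
move=> eE s_all s_uniq near_r <-; split; last exact: cZgE.
exact: within_two_game_graph near_r.
Qed.

Lemma list_graph_game n l (G := list_graph n l) (s : seq G := cord_enum n)
    (r : G) k :
  within_two (@edge G) s r -> cZg (@edge G) s = k ->
  game_graph G /\ Zg G = k.
Proof.
apply: game_graph_Zg => //; first exact: mem_cord_enum.
exact: cord_enum_uniq.
Qed.

Lemma del_edge_game n l (G := list_graph n l) (s : seq G := cord_enum n)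
    (x y : G) (e := cdel_edge (@edge G) x y) (r : G) k :
  within_two (G := del_edge x y) e s r -> cZg (G := del_edge x y) e s = k ->
  game_graph (del_edge x y) /\ Zg (del_edge x y) = k.
Proof.
apply: (@game_graph_Zg (del_edge x y)); first exact: (@cdel_edgeE G).
  exact: mem_cord_enum.
exact: cord_enum_uniq.
Qed.

Lemma del_vertex_game n l (G := list_graph n l) (v : G)
    (H := del_vertex v) (s : seq H := @cdel_vertex G (cord_enum n) v) (r : H) k :
  within_two (@edge H) s r -> cZg (@edge H) s = k ->
  game_graph H /\ Zg H = k.
Proof.
apply: game_graph_Zg => //.
  exact/(@mem_cdel_vertex G)/mem_cord_enum.
exact/(@cdel_vertex_uniq G)/cord_enum_uniq.
Qed.

Theorem proposition23 :
  (exists (G : sgraph) (v : G),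
     game_graph G /\ game_graph (del_vertex v) /\ Zg G < Zg (del_vertex v)) /\
  (exists (G : sgraph) (v : G),
     game_graph G /\ game_graph (del_vertex v) /\ Zg (del_vertex v) < Zg G) /\
  (exists (G : sgraph) (x y : G), x -- y /\
     game_graph G /\ game_graph (del_edge x y) /\ Zg G < Zg (del_edge x y)) /\
  (exists (G : sgraph) (x y : G), x -- y /\
     game_graph G /\ game_graph (del_edge x y) /\ Zg (del_edge x y) < Zg G) /\
  (exists G H : sgraph,
     game_graph G /\ game_graph H /\ minor G H /\ Zg G < Zg H).
Proof.
pose i4 k (lt_k : k < 4) : 'I_4 := Ordinal lt_k.
pose i5 k (lt_k : k < 5) : 'I_5 := Ordinal lt_k.
have [claw_game Zg_claw] : game_graph claw /\ Zg claw = 3.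
  (* Vertex [0] is within distance two of every vertex, here and in all the graphs below;
     [vm_compute] explores the whole game tree. *)
  by apply: (@list_graph_game 4 _ (i4 0 isT)); vm_compute.
have [paw_game Zg_paw] : game_graph paw /\ Zg paw = 2.
  by apply: (@list_graph_game 4 _ (i4 0 isT)); vm_compute.
have [K4_game Zg_K4] : game_graph K4 /\ Zg K4 = 3.
  by apply: (@list_graph_game 4 _ (i4 0 isT)); vm_compute.
have [spider_game Zg_spider] : game_graph spider /\ Zg spider = 2.
  by apply: (@list_graph_game 5 _ (i5 0 isT)); vm_compute.
pose leaf : claw := i4 3 isT.
have [path_game Zg_path] :
    game_graph (del_vertex leaf) /\ Zg (del_vertex leaf) = 2.
  pose r : del_vertex leaf := exist _ (i4 0 isT) isT.
  by apply: (@del_vertex_game 4 _ leaf r); vm_compute.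
pose tip : spider := i5 4 isT.
(* This claw lives on a subtype of the spider's vertices, so it is not literally [claw] and its
   value is computed afresh. *)
have [claw'_game Zg_claw'] :
    game_graph (del_vertex tip) /\ Zg (del_vertex tip) = 3.
  pose r : del_vertex tip := exist _ (i5 0 isT) isT.
  by apply: (@del_vertex_game 5 _ tip r); vm_compute.
(* The triangle edge that avoids the vertex carrying the pendant edge. *)
pose x : paw := i4 1 isT; pose y : paw := i4 2 isT.
have [paw_del_game Zg_paw_del] :
    game_graph (del_edge x y) /\ Zg (del_edge x y) = 3.
  by apply: (@del_edge_game 4 _ x y (i4 0 isT)); vm_compute.
pose z : K4 := i4 1 isT; pose t : K4 := i4 2 isT.
have [K4_del_game Zg_K4_del] :
    game_graph (del_edge z t) /\ Zg (del_edge z t) = 2.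
  by apply: (@del_edge_game 4 _ z t (i4 0 isT)); vm_compute.
split; first by exists spider, tip; rewrite Zg_spider Zg_claw'.
split; first by exists claw, leaf; rewrite Zg_claw Zg_path.
split; first by exists paw, x, y; rewrite Zg_paw Zg_paw_del.
split; first by exists K4, z, t; rewrite Zg_K4 Zg_K4_del.
have isom_refl G : isomorphic G G by exists id; split=> //; exists id.
(* The example of an edge deletion raising the value is also a minor, obtained in one step. *)
exists paw, (del_edge x y); rewrite Zg_paw Zg_paw_del; do 3?split=> //.
by apply: (@minor_del_edge _ paw _ x y) => //; apply: minor_iso.
Qed.
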